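(* For each $n$ let $0=s_1<\dots<s_n=1$ be a design (depending on $n$), with $\Delta_i=s_i-s_{i-1}$ for $i=2,\dots,n$, such that $\limsup_{n\to\infty}\max_{i=2,\dots,n}\Delta_i=0$. Let $$\tau_n^2=\frac{2}{n}\sum_{i=3}^{n-1}\left[\left(\frac{\Delta_{i+1}}{\Delta_i+\Delta_{i+1}}+\frac{\Delta_{i-1}}{\Delta_i+\Delta_{i-1}}\right)^2+2\,\frac{\Delta_i\Delta_{i+1}}{(\Delta_i+\Delta_{i+1})^2}\right].$$ Then $$2\le\liminf_{n\to\infty}\tau_n^2\le\limsup_{n\to\infty}\tau_n^2\le4.$$
   Context: The design points $s_i$ and spacings $\Delta_i$ form triangular arrays; their dependence on $n$ is not written. *)

(* Defs.v *)
From HB Require Import structures.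
From mathcomp Require Import all_boot all_order all_algebra.
From mathcomp Require Import all_classical all_reals all_analysis.

Set Implicit Arguments.
Unset Strict Implicit.
Unset Printing Implicit Defensive.

Import Order.TTheory GRing.Theory Num.Theory.
Import numFieldNormedType.Exports.

Local Open Scope ring_scope.

(* Row n of the triangular array is a function t of a 1-based index; only
   t 1, ..., t n are meaningful, other values are unconstrained and unused. *)
Definition is_design (R : realType) (n : nat) (t : nat -> R) : Prop :=
  [/\ t 1%N = 0, t n = 1 &
      forall i : nat, (2 <= i <= n)%N -> t i.-1 < t i].

Definition spacing (R : realType) (t : nat -> R) (i : nat) : R :=
  t i - t i.-1.

(* The base value 0 of the iterated maximum is harmless: for a design with
   n >= 2 the range is nonempty and all spacings are positive. *)
Definition max_spacing (R : realType) (n : nat) (t : nat -> R) : R :=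
  \big[Num.max/0]_(2 <= i < n.+1) spacing t i.

Definition tau_sq (R : realType) (n : nat) (t : nat -> R) : R :=
  2 / n%:R * \sum_(3 <= i < n)
    ((spacing t i.+1 / (spacing t i + spacing t i.+1)
      + spacing t i.-1 / (spacing t i + spacing t i.-1)) ^+ 2
     + 2 * (spacing t i * spacing t i.+1
            / (spacing t i + spacing t i.+1) ^+ 2)).

(* Main.v *)
(** With x_i = D_{i+1} / (D_i + D_{i+1}) in [0, 1], where D_i is the i-th
    spacing, the i-th summand of tau_n^2 is
    (1 + x_i - x_{i-1})^2 + 2 x_i (1 - x_i).  Modulo the telescoping terms
    g(x_i) - g(x_{i-1}), with g(x) = 2x - x^2, it equals
    1 + 2 x_i (1 - x_{i-1}).  This is at least 1, and, since
    2ab <= a + b for a, b in [0, 1], at most 2 modulo the telescoping terms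
    x_i - x_{i-1}.  So the sum lies between n and 2n up to a bounded error. *)
Require Import Defs.
From HB Require Import structures.
From mathcomp Require Import all_boot all_order all_algebra.
From mathcomp Require Import all_classical all_reals all_analysis.
From mathcomp Require Import zify ring lra.

Import Order.TTheory GRing.Theory Num.Theory.
Import numFieldNormedType.Exports.

Local Open Scope ring_scope.

(** A limsup is the limit of the tail suprema, and these compare termwise beyond the rank where
    [u <= v] sets in. The eventual form is needed because the bounds on [tau_sq] are proved only for
    [3 < n]. *)
Lemma le_limn_esup (R : realType) (u v : nat -> \bar R) :
  (\forall n \near \oo, (u n <= v n)%E)%classic -> (limn_esup u <= limn_esup v)%E.
Proof.
move=> [N _ uv]; rewrite !limn_esup_lim.
apply: lee_lim; [exact: is_cvg_esups|exact: is_cvg_esups|].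
exists N => // m /= Nm; apply: ub_ereal_sup => _ [k /= mk <-].
apply: (le_trans (uv k (leq_trans Nm mk))).
by apply: ereal_sup_ubound; exists k.
Qed.

Lemma le_limn_einf (R : realType) (u v : nat -> \bar R) :
  (\forall n \near \oo, (u n <= v n)%E)%classic -> (limn_einf u <= limn_einf v)%E.
Proof.
move=> uv; rewrite /limn_einf leeN2; apply: le_limn_esup.
by apply: filterS uv => n; rewrite leeN2.
Qed.

Lemma spacing_gt0 (R : realType) (n : nat) (t : nat -> R) (i : nat) :
  is_design n t -> (2 <= i <= n)%N -> 0 < spacing t i.
Proof. by case=> _ _ t_incr /t_incr; rewrite /spacing subr_gt0. Qed.

Definition spacing_ratio {R : realType} (t : nat -> R) (i : nat) : R :=
  spacing t i.+1 / (spacing t i + spacing t i.+1).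

Lemma spacing_ratio_itv (R : realType) (n : nat) (t : nat -> R) (i : nat) :
  is_design n t -> (2 <= i < n)%N -> 0 <= spacing_ratio t i <= 1.
Proof.
move=> dt /andP[i2 iltn].
have a0 : 0 < spacing t i by apply: spacing_gt0 dt _; lia.
have b0 : 0 < spacing t i.+1 by apply: spacing_gt0 dt _; lia.
rewrite /spacing_ratio divr_ge0/= ?ler_pdivrMr; lra.
Qed.

(** The two weights attached to a pair of adjacent spacings add up to 1, so D_{i-1} / (D_i +
    D_{i-1}) = 1 - x_{i-1}, and the product term is x_i (1 - x_i). *)
Lemma tau_sq_ratio (R : realType) (n : nat) (t : nat -> R) :
  is_design n t ->
  tau_sq n t = 2 / n%:R * \sum_(3 <= i < n)
    ((1 + spacing_ratio t i - spacing_ratio t i.-1) ^+ 2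
     + 2 * (spacing_ratio t i * (1 - spacing_ratio t i))).
Proof.
move=> dt; congr (_ * _); apply: eq_big_nat => -[|i]; first by [].
move=> /andP[i3 iltn] /=; rewrite /spacing_ratio.
have := @spacing_gt0 _ _ _ i dt ltac:(lia).
have := @spacing_gt0 _ _ _ i.+1 dt ltac:(lia).
have := @spacing_gt0 _ _ _ i.+2 dt ltac:(lia).
set a := spacing t i; set b := spacing t i.+1; set c := spacing t i.+2.
move=> c0 b0 a0.
by field; apply/andP; split; apply: lt0r_neq0; lra.
Qed.

Lemma tau_sq_bounds (R : realType) (n : nat) (t : nat -> R) :
  (3 < n)%N -> is_design n t -> 2 - 8 / n%:R <= tau_sq n t <= 4.
Proof.
move=> n3 dt; rewrite (tau_sq_ratio _ _ _ dt).
set S := \sum_(3 <= i < n) _.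
have n0 : 0 < n%:R :> R by rewrite ltr0n; lia.
pose x := spacing_ratio t.
have x01 i : (2 <= i < n)%N -> 0 <= x i <= 1 by exact: spacing_ratio_itv dt.
(* There are n - 3 summands, and the ratios involved have indices 2 to n - 1, exactly those covered
   by [x01]. *)
have tele (f : R -> R) (c : R) : \sum_(3 <= i < n) (c + (f (x i) - f (x i.-1))) =
    c * (n%:R - 3) + (f (x n.-1) - f (x 2)).
  rewrite big_split/= sumr_const_nat -[c *+ _]mulr_natr natrB; last by lia.
  congr (_ + _); rewrite -{1}(ltn_predK n3) big_add1 -/x/=.
  by rewrite (telescope_sumr (fun i => f (x i)))//; lia.
(* [h] is [g] plus the identity; the added y telescopes the x_i - x_{i-1} left by 2 x_i (1 -
   x_{i-1}) <= 1 + x_i - x_{i-1}. *)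
pose g (y : R) := 2 * y - y ^+ 2; pose h (y : R) := 3 * y - y ^+ 2.
(* [g] maps [0, 1] into [0, 1], so the boundary terms cost at most 1: (n - 3) - 1. *)
have lbS : n%:R - 4 <= S.
  apply: (@le_trans _ _ (\sum_(3 <= i < n) (1 + (g (x i) - g (x i.-1))))).
    rewrite tele /g.
    have := x01 n.-1 ltac:(lia); have := x01 2 ltac:(lia); nra.
  apply: ler_sum_nat => i i3; rewrite -/x /g.
  have := x01 i ltac:(lia); have := x01 i.-1 ltac:(lia); nra.
(* [h] maps [0, 1] into [0, 2], so the boundary terms add at most 2: 2 (n - 3) + 2. *)
have ubS : S <= 2 * n%:R - 4.
  apply: (@le_trans _ _ (\sum_(3 <= i < n) (2 + (h (x i) - h (x i.-1))))).
    apply: ler_sum_nat => i i3; rewrite -/x /h.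
    have := x01 i ltac:(lia); have := x01 i.-1 ltac:(lia); nra.
  rewrite tele /h.
  have := x01 n.-1 ltac:(lia); have := x01 2 ltac:(lia); nra.
have -> : 2 - 8 / n%:R = 2 / n%:R * (n%:R - 4) :> R.
  by field; exact: lt0r_neq0.
rewrite ler_pM2l ?divr_gt0// lbS/= mulrAC ler_pdivrMr//; lra.
Qed.

Theorem proposition4p3 (R : realType) (s : nat -> nat -> R)
    (s_design : forall n : nat, (2 <= n)%N -> is_design n (s n))
    (mesh0 : limn_esup (fun n : nat => (max_spacing n (s n))%:E) = 0%E) :
  [/\ (2%:E <= limn_einf (fun n : nat => (tau_sq n (s n))%:E))%E,
      (limn_einf (fun n : nat => (tau_sq n (s n))%:E)
         <= limn_esup (fun n : nat => (tau_sq n (s n))%:E))%E &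
      (limn_esup (fun n : nat => (tau_sq n (s n))%:E) <= 4%:E)%E].
Proof.
have bounds : (\forall n \near \oo, 2 - 8 / n%:R <= tau_sq n (s n) <= 4)%classic.
  exists 4%N => // n /= n4; apply: tau_sq_bounds => //.
  by apply: s_design; exact: leq_trans n4.
split; first 1 last.
- exact: limn_einf_sup.
(* The bound 4 is read as the limsup of a constant sequence. *)
- rewrite -(cvg_limn_einf_sup (@cvg_cst _ 4%:E nat \oo%classic _)).2.
  by apply: le_limn_esup; apply: filterS bounds => n; rewrite lee_fin => /andP[].
have lim2 : ((2 - 8 / n%:R)%:E @[n --> \oo] --> (2%:E : \bar R))%classic.
  apply: cvg_EFin; first exact: nearW.
  rewrite -[2 in X in (_ --> X)%classic]subr0 -(mulr0 8).
  apply: cvgB; first exact: cvg_cst.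
  (* The harmonic sequence is 1 / (n + 1), hence the shift by one. *)
  apply: cvgMr; rewrite -(cvg_shiftS _); exact: cvg_harmonic.
rewrite -(cvg_limn_einf_sup lim2).1; apply: le_limn_einf.
by apply: filterS bounds => n; rewrite lee_fin => /andP[].
Qed.
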